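(* Let $(X,\mathfrak{M})$ be a measurable space and let $G$ be a nonnegative, product measurable function on $X \times X$ (with values in $[0,+\infty]$). For measurable $E\subset X$ define the energy $$W(E) = \inf_\mu \int_E \int_E G(x,y) \, d\mu(x)\, d\mu(y),$$ where the infimum is taken over all probability measures $\mu$ on $E$, that is, measures $\mu$ on $\mathfrak{M}$ with $\mu(E)=1$, with $W(E)=+\infty$ if $E$ supports no probability measure. If $E_1, E_2, E_3, \ldots$ are measurable subsets of $X$, then $$\frac{1}{W\left(\bigcup_i E_i\right)} \leq \sum_i \frac{1}{W(E_i)} .$$
   Context: The infimum defining $W(E)$ is not required to be attained. In particular $W(\emptyset)=+\infty$. Conventions in $[0,+\infty]$: $1/(+\infty)=0$ and $1/0=+\infty$. A probability measure on $E$ is regarded as a measure $\mu$ on $\mathfrak{M}$ concentrated on $E$ (only its restriction to $E$ matters). *)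

(* Defs.v *)
From mathcomp Require Export all_boot all_order all_algebra.
From mathcomp Require Export all_classical all_reals all_analysis measurable_realfun.

Set Implicit Arguments.
Unset Strict Implicit.
Unset Printing Implicit Defensive.

Local Open Scope classical_set_scope.
Local Open Scope ring_scope.
Local Open Scope ereal_scope.

(* Only the restriction of [mu] to [E] matters here: no condition is imposed
   on [mu] outside [E].  Since [ereal_inf set0 = +oo], the energy is [+oo]
   when [E] supports no probability measure. *)
Definition energy (d : measure_display) (T : measurableType d) (R : realType)
    (G : T * T -> \bar R) (E : set T) : \bar R :=
  ereal_inf [set \int[mu]_(y in E) \int[mu]_(x in E) G (x, y)
            | mu in [set mu : {measure set T -> \bar R} | mu E = 1]].

(* Main.v *)
(** Cut the union into disjoint pieces [F i `<=` E i].  For [mu] of mass 1 on the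
    union and [m i = mu (F i)], dropping the cross terms of the double integral
    (G >= 0) and rescaling [mu] on each [F i] gives [I(mu) >= \sum m_i^2 W(E_i)].
    Since [\sum m_i = 1], Cauchy-Schwarz yields [1 <= I(mu) * \sum 1 / W(E_i)].
    To avoid the products [0 * oo], Cauchy-Schwarz is used in its linearized form
    [2 t m <= m^2 w + t^2 / w] for all [t > 0]. *)
Require Import Defs.
From mathcomp Require Import ring lra.
Import Order.TTheory GRing.Theory Num.Theory.

Set Implicit Arguments.
Unset Strict Implicit.

Local Open Scope classical_set_scope.
Local Open Scope ring_scope.
Local Open Scope ereal_scope.

(** Tonelli asks for a sigma-finite measure, while [mu] is arbitrary outside [F]. It is therefore
    applied to the restriction of [mu] to [F], a finite measure, with [G] cut off to [F] in the
    first variable. *)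
Lemma measurable_potential (d : measure_display) (T : measurableType d)
    (R : realType) (G : T * T -> \bar R) (mu : {measure set T -> \bar R})
    (F : set T) :
  (forall p, 0 <= G p) -> measurable_fun [set: T * T] G ->
  measurable F -> mu F < +oo ->
  measurable_fun [set: T] (fun y => \int[mu]_(x in F) G (x, y)).
Proof.
move=> G0 mG mF muF.
have mGF : measurable_fun [set: T * T] (G \_ (F `*` setT)).
  apply/(measurable_restrictT G (measurableX mF measurableT)).
  exact: measurable_funTS.
have GF0 p : 0 <= (G \_ (F `*` setT)) p by rewrite patchE; case: ifP.
have := measurable_fun_fubini_tonelli_G (m1 := mfrestr mF muF) _ mGF GF0.
congr measurable_fun; apply/funext => y; rewrite /fubini_G.
transitivity (\int[mfrestr mF muF]_(x in F) G (x, y)).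
  rewrite [RHS]integral_mkcond; apply: eq_integral => x _.
  by rewrite !patchE; congr (if _ then _ else _); apply/idP/idP; rewrite !inE//= => -[].
by apply: eq_measure_integral => A mA AF; rewrite /= /mfrestr /mrestr setIidl.
Qed.

(** A competitor [mu] for [F] may charge [E] outside [F], so it need not compete for [E]. Its
    restriction to [F] does, with the same double integral. *)
Lemma energy_anti (d : measure_display) (T : measurableType d)
    (R : realType) (G : T * T -> \bar R) (E F : set T) :
  (forall p, 0 <= G p) -> measurable_fun [set: T * T] G ->
  measurable E -> measurable F -> F `<=` E -> energy G E <= energy G F.
Proof.
move=> G0 mG mE mF FE; apply: le_ereal_inf_tmp => _ [mu /= muF1 <-].
have muF : mu F < +oo by rewrite muF1 ltry.
pose nu := mfrestr mF muF.
have nuE : nu E = 1 by rewrite /nu /mfrestr /mrestr setIidr.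
have intE (f : T -> \bar R) : measurable_fun E f -> (forall x, 0 <= f x) ->
    \int[nu]_(x in E) f x = \int[mu]_(x in F) f x.
  move=> mf f0; rewrite (@ge0_negligible_integral _ _ _ nu _ (E `\` F))//.
  - rewrite setDD setIidr//; apply: eq_measure_integral => A mA AF.
    by rewrite /= /mfrestr /mrestr setIidl.
  - exact: measurableD.
  - by rewrite /nu /= /mfrestr /mrestr setDKI measure0.
apply: ereal_inf_lbound; exists nu => //=.
have mG2 y : measurable_fun E (fun x => G (x, y)).
  by apply: measurable_funTS; exact: measurableT_comp.
rewrite intE.
- by apply: eq_integral => y _; rewrite intE.
- apply: measurable_funTS; apply: measurable_potential => //.
  by rewrite [X in X < _]nuE ltry.
- by move=> y; apply: integral_ge0.
Qed.

(** For [m > 0], the measure [mu / m] competes for [F], and each of the two integrals contributes a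
    factor [m^-1]. For [m = 0] the left side is [0], even if the energy is [+oo]. *)
Lemma energy_scale_le (d : measure_display) (T : measurableType d)
    (R : realType) (G : T * T -> \bar R) (mu : {measure set T -> \bar R})
    (F : set T) (m : R) :
  (forall p, 0 <= G p) -> measurable_fun [set: T * T] G ->
  measurable F -> mu F = m%:E ->
  (m ^+ 2)%:E * energy G F <= \int[mu]_(y in F) \int[mu]_(x in F) G (x, y).
Proof.
move=> G0 mG mF muF.
have m0 : (0 <= m)%R by rewrite -lee_fin -muF.
have [->|mN0] := eqVneq m 0%R.
  by rewrite expr0n/= mul0e integral_ge0// => y _; exact: integral_ge0.
have mp : (0 < m)%R by rewrite lt_def mN0.
have mV0 : (0 <= m^-1)%R by rewrite invr_ge0.
pose nu := mscale (NngNum mV0) mu.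
rewrite -lee_pdivlMl ?exprn_gt0//.
apply: ereal_inf_lbound; exists nu => /=.
  by rewrite /nu /mscale /= muF -EFinM mulVf.
have mG2 y : measurable_fun F (fun x => G (x, y)).
  by apply: measurable_funTS; exact: measurableT_comp.
have mP : measurable_fun F (fun y => \int[mu]_(x in F) G (x, y)).
  by apply: measurable_funTS; apply: measurable_potential; rewrite ?muF ?ltry.
have P0 y : 0 <= \int[mu]_(x in F) G (x, y) by exact: integral_ge0.
have nuE f : measurable_fun F f -> (forall x, 0 <= f x) ->
    \int[nu]_(x in F) f x = m^-1%:E * \int[mu]_(x in F) f x.
  by move=> mf f0; rewrite ge0_integral_mscale.
transitivity (\int[nu]_(y in F) (m^-1%:E * \int[mu]_(x in F) G (x, y))).
  by apply: eq_integral => y _; exact: nuE.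
rewrite nuE//.
- by rewrite ge0_integralZl// muleA -EFinM -exprVn expr2.
- exact: measurable_funeM.
- by move=> y; rewrite mule_ge0.
Qed.

(* Weighted AM-GM; the hypothesis [0 < t] is what makes it survive [w = 0],
   where the last term is [+oo]. *)
Lemma amgm_inve (R : realType) (t m : R) (w : \bar R) :
  (0 < t)%R -> (0 <= m)%R -> 0 <= w ->
  (2 * t)%:E * m%:E <= (m ^+ 2)%:E * w + (t ^+ 2)%:E * w^-1.
Proof.
move=> t0 m0; case: w => [w| |]//; last first.
  move=> _; rewrite invey mule0 adde0.
  have [->|mN0] := eqVneq m 0%R; first by rewrite mule0 expr0n mul0e.
  by rewrite gt0_muley ?leey// lte_fin exprn_gt0// lt_def mN0.
rewrite lee_fin le_eqVlt => /predU1P[<-|w0].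
  by rewrite inve0 mule0 add0e gt0_muley ?leey// lte_fin exprn_gt0.
rewrite inver gt_eqF// -!EFinM -EFinD lee_fin.
rewrite -subr_ge0 (_ : _ - _ = (m * w - t) ^+ 2 / w)%R.
  by rewrite divr_ge0 ?sqr_ge0// ltW.
by field; rewrite gt_eqF.
Qed.

Lemma energy_ge0 (d : measure_display) (T : measurableType d) (R : realType)
    (G : T * T -> \bar R) (E : set T) :
  (forall p, 0 <= G p) -> 0 <= energy G E.
Proof.
move=> G0; apply: le_ereal_inf_tmp => _ [mu _ <-].
by apply: integral_ge0 => y _; exact: integral_ge0.
Qed.

Lemma double_integral_bigcup_ge (d : measure_display) (T : measurableType d)
    (R : realType) (G : T * T -> \bar R) (mu : {measure set T -> \bar R})
    (F : nat -> set T) :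
  (forall p, 0 <= G p) -> measurable_fun [set: T * T] G ->
  (forall i, measurable (F i)) -> trivIset setT F ->
  mu (\bigcup_i F i) < +oo ->
  \sum_(0 <= i <oo) \int[mu]_(y in F i) \int[mu]_(x in F i) G (x, y) <=
  \int[mu]_(y in \bigcup_i F i) \int[mu]_(x in \bigcup_i F i) G (x, y).
Proof.
move=> G0 mG mF tF muF.
have mU : measurable (\bigcup_i F i) by exact: bigcupT_measurable.
have P0 A y : 0 <= \int[mu]_(x in A) G (x, y) by exact: integral_ge0.
(* Only the outer integral is split; on each piece the inner domain then shrinks from the union to
   [F i]. *)
rewrite [leRHS]ge0_integral_bigcup//; last first.
  by apply: measurable_funTS; exact: measurable_potential.
apply: lee_nneseries => [i _ _|i _]; first exact: integral_ge0.
have FU : F i `<=` \bigcup_i F i by exact: bigcup_sup.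
apply: ge0_le_integral => //.
- apply: measurable_funTS; apply: measurable_potential => //.
  by rewrite (le_lt_trans _ muF)// le_measure ?inE.
- by apply: measurable_funTS; exact: measurable_potential.
- move=> y _; apply: ge0_subset_integral => //.
  by apply: measurable_funTS; exact: measurableT_comp.
Qed.

(** Undoes the linearization by optimizing over [t]. *)
Lemma inve_le_of_linear (R : realType) (s I : \bar R) :
  0 <= s -> 0 <= I ->
  (forall t : R, (0 < t)%R -> (2 * t)%:E <= I + (t ^+ 2)%:E * s) -> s^-1 <= I.
Proof.
case: I => [I| |] s0 // I0 st; last by rewrite leey.
case: s s0 st => [s| |]//.
rewrite lee_fin in I0; rewrite lee_fin => + st; rewrite le_eqVlt => /predU1P[s0|s0].
  (* If [s = 0], the hypothesis reads [2 t <= I] and fails at [t = I + 1]. *)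
  have I1 : (0 < I + 1)%R by rewrite ltr_wpDl.
  move: (st _ I1) => {st}; rewrite -s0 mule0 adde0 lee_fin => ?; exfalso; lra.
(* The optimal [t] is [s^-1], giving [2 / s <= I + 1 / s]. *)
have sV0 : (0 < s^-1)%R by rewrite invr_gt0.
move: (st _ sV0) => {st}; rewrite inver gt_eqF// -EFinM -EFinD !lee_fin.
rewrite expr2 -mulrA mulVf ?gt_eqF// mulr1; lra.
Qed.

(* [inve] satisfies [0^-1 = +oo] and [+oo^-1 = 0] in [\bar R]. *)
Theorem proposition3p1 (d : measure_display) (T : measurableType d)
    (R : realType) (G : T * T -> \bar R)
    (G_ge0 : forall p : T * T, 0 <= G p)
    (mG : measurable_fun [set: T * T] G)
    (E : nat -> set T) (mE : forall i : nat, measurable (E i)) :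
  (energy G (\bigcup_i E i))^-1 <= \sum_(0 <= i <oo) (energy G (E i))^-1.
Proof.
have W0 i : 0 <= (energy G (E i))^-1 by rewrite inve_ge0 energy_ge0.
have S0 : 0 <= \sum_(0 <= i <oo) (energy G (E i))^-1 by exact: nneseries_ge0.
(* Inverting both sides puts the energy alone on the right, so that each competitor [mu] can be
   treated separately. *)
rewrite inve_ple ?inE ?energy_ge0//.
apply: le_ereal_inf_tmp => _ [mu /= muE <-].
apply: inve_le_of_linear => // [|t t0].
  by apply: integral_ge0 => y _; exact: integral_ge0.
pose F := seqDU E.
have UF : \bigcup_i E i = \bigcup_i F i by exact: seqDU_bigcup_eq.
have mF i : measurable (F i).
  exact: seqDU_measurable.
have tF : trivIset setT F by exact: trivIset_seqDU.
have muU : mu (\bigcup_i F i) = 1 by rewrite -UF.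
have mUF : measurable (\bigcup_i F i) by exact: bigcupT_measurable.
have muF i : mu (F i) = (fine (mu (F i)))%:E.
  rewrite fineK// ge0_fin_numE// (@le_lt_trans _ _ 1) ?ltry// -muU.
  by rewrite le_measure ?inE//; exact: bigcup_sup.
have m0 i : (0 <= fine (mu (F i)))%R by exact: fine_ge0.
have muUy : mu (\bigcup_i F i) < +oo by rewrite muU ltry.
rewrite UF.
apply: (le_trans _ (leeD2r _ (double_integral_bigcup_ge G_ge0 mG mF tF muUy))).
rewrite -nneseriesZl// -nneseriesD//; last 2 first.
- by move=> i _ _; apply: integral_ge0 => y _; exact: integral_ge0.
- by move=> i _ _; rewrite mule_ge0// lee_fin sqr_ge0.
(* Since [mu] has mass 1 on the union, [2 t] is the sum of the [2 t * mu (F i)], and the two series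
   can be compared term by term. *)
rewrite -[leLHS]mule1 -muU measure_semi_bigcup// -nneseriesZl//.
apply: lee_nneseries => [i _ _|i _].
  by rewrite mule_ge0// lee_fin mulr_ge0// ltW.
rewrite {1}muF; apply: (le_trans (amgm_inve t0 (m0 i) (energy_ge0 (E i) G_ge0))).
apply: leeD2r; apply: (le_trans _ (energy_scale_le G_ge0 mG (mF i) (muF i))).
apply: lee_wpmul2l; first by rewrite lee_fin sqr_ge0.
by apply: energy_anti => //; exact: subset_seqDU.
Qed.
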